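(* For all integers $a\geq b\geq 3$ there exists a diagonal $\mathrm{SMA}(a;b)$. Moreover, if $b$ is even, then for all $a\geq b\geq 3$ there exists a shiftable diagonal $\mathrm{SMA}(a;b)$.
   Context: A partially filled (pf) array is a matrix some of whose cells may be empty; row and column sums are taken over the filled cells. A signed magic square $\mathrm{SMA}(a;b)$ is an $a\times a$ pf array with entries in $\Omega\subset\mathbb{Z}$, where $\Omega=\{0,\pm1,\ldots,\pm(ab-1)/2\}$ if $ab$ is odd and $\Omega=\{\pm1,\ldots,\pm ab/2\}$ if $ab$ is even, such that: (a) each row and each column contains exactly $b$ filled cells; (b) every $x\in\Omega$ appears exactly once; (c) the elements in every row and column sum to $0$. With rows and columns indexed by $\{1,\ldots,a\}$, the cell $(i,j)$ belongs to the diagonal $D_r$ if $j-i\equiv r\pmod a$. An $\mathrm{SMA}(a;b)$ is diagonal if its filled cells are exactly those of $b$ consecutive diagonals $D_r,\ldots,D_{r+b-1}$ (indices modulo $a$). A pf array with entries in $\mathbb{Z}$ is shiftable if every row and every column contains an equal number of positive and negative entries. *)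

(* Defs.v *)
From HB Require Import structures.
From mathcomp Require Import all_boot all_order all_algebra.
Set Implicit Arguments.
Unset Strict Implicit.
Unset Printing Implicit Defensive.
Import Order.TTheory GRing.Theory Num.Theory.
Local Open Scope ring_scope.

(* [None] is an empty cell. *)
Definition pfarray (m n : nat) := 'M[option int]_(m, n).

Definition filled (m n : nat) (A : pfarray m n) (i : 'I_m) (j : 'I_n) : bool :=
  isSome (A i j).

(* An empty cell contributes 0, so these are the sums over the filled cells. *)
Definition row_sum (m n : nat) (A : pfarray m n) (i : 'I_m) : int :=
  \sum_(j < n) odflt 0 (A i j).

Definition col_sum (m n : nat) (A : pfarray m n) (j : 'I_n) : int :=
  \sum_(i < m) odflt 0 (A i j).

Definition Omega (a b : nat) : pred int :=
  fun x => if odd (a * b) then (absz x <= (a * b - 1)./2)%N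
           else (x != 0) && (absz x <= (a * b)./2)%N.

Record is_SMA (a b : nat) (A : pfarray a a) : Prop := IsSMA {
  SMA_entries : forall i j x, A i j = Some x -> Omega a b x;
  SMA_row_filled : forall i, #|[set j | filled A i j]| = b;
  SMA_col_filled : forall j, #|[set i | filled A i j]| = b;
  SMA_once : forall x, Omega a b x ->
    #|[set ij : 'I_a * 'I_a | A ij.1 ij.2 == Some x]| = 1%N;
  SMA_row_sum : forall i, row_sum A i = 0;
  SMA_col_sum : forall j, col_sum A j = 0
}.

(* Indices start at 0 rather than 1; this does not affect j - i. *)
Definition in_diag (a : nat) (r : int) (i j : 'I_a) : bool :=
  (j%:Z - i%:Z == r %[mod a%:Z])%Z.

Definition is_diagonal (a b : nat) (A : pfarray a a) : Prop :=
  exists r : int, forall i j,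
    filled A i j <-> exists k : 'I_b, in_diag (r + k%:Z) i j.

Definition pos_cell (c : option int) : bool := if c is Some x then 0 < x else false.

Definition neg_cell (c : option int) : bool := if c is Some x then x < 0 else false.

Definition shiftable (m n : nat) (A : pfarray m n) : Prop :=
  (forall i, #|[set j | pos_cell (A i j)]| = #|[set j | neg_cell (A i j)]|) /\
  (forall j, #|[set i | pos_cell (A i j)]| = #|[set i | neg_cell (A i j)]|).

(* Main.v *)
Require Import Defs.
From mathcomp Require Import all_boot all_order all_algebra.
From mathcomp Require Import zify.

(* The entries are given diagonal by diagonal: [D r i] is the entry of the r-th
   of the b diagonals in row i, so column j collects the entries [D r (j - r)]
   with [j - r] modulo a.  Put N = floor(ab/2), f(i) = N + 2i + 1 and
   g(i) = N + 2i + 2.  Appending the four diagonals f(i), - g(i), - f(i + 2),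
   g(i + 2) to a solution for b gives one for b + 4: in a row the new entries
   sum to (f - g)(i) - (f - g)(i + 2) = 0, and in a column they cancel in pairs.
   Starting from b = 0, 3, 5, 6 all b >= 3 are reached; b = 6 has a uniform
   solution, and b = 3, 5 have one for each of the cases a odd, a = 0 mod 4 and
   a = 2 mod 4.  Injectivity and the size of Omega force every element of Omega
   to occur.  Since each of the diagonals used for even b has constant sign,
   half of them positive, shiftability amounts to the signs of the entries
   having zero row and column sums as well. *)

Set Implicit Arguments.
Unset Strict Implicit.
Unset Printing Implicit Defensive.
Import Order.TTheory GRing.Theory Num.Theory.
Local Open Scope ring_scope.

(** * Entries diagonal by diagonal, and the set Omega *)

Definition cyc_sub (a j r : nat) : nat :=
  if (r <= j)%N then (j - r)%N else (j + a - r)%N.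

Record diag_data (a b : nat) (D : nat -> nat -> int) : Prop := DiagData {
  dd_inj : forall r r' i i', (r < b)%N -> (r' < b)%N -> (i < a)%N ->
    (i' < a)%N -> D r i = D r' i' -> r = r' /\ i = i';
  dd_range : forall r i, (r < b)%N -> (i < a)%N ->
    (absz (D r i) <= (a * b)./2)%N && (odd (a * b) || (D r i != 0));
  dd_row : forall i, (i < a)%N -> \sum_(r < b) D r i = 0;
  dd_col : forall j, (j < a)%N -> \sum_(r < b) D r (cyc_sub a j r) = 0
}.

Definition sign_balanced (a b : nat) (D : nat -> nat -> int) : Prop :=
  (forall i, (i < a)%N -> \sum_(r < b) sgz (D r i) = 0) /\
  (forall j, (j < a)%N -> \sum_(r < b) sgz (D r (cyc_sub a j r)) = 0).

Lemma OmegaE (a b : nat) (x : int) :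
  Omega a b x = (absz x <= (a * b)./2)%N && (odd (a * b) || (x != 0)).
Proof.
rewrite /Omega; case: ifP => oab /=; last by rewrite andbC.
by rewrite andbT; move: oab; move: (a * b)%N => c oc; f_equal; lia.
Qed.

Lemma sub_ord_cyc (n : nat) (j r : 'I_n.+1) : (j - r)%R = cyc_sub n.+1 j r :> nat.
Proof.
have jn := ltn_ord j; have rn := ltn_ord r; rewrite /= modnDmr /cyc_sub.
case: leqP => jr.
  by rewrite addnBA ?(ltnW rn)// addnC -addnBA// modnDl modn_small //; lia.
by rewrite modn_small; lia.
Qed.

(** * From diagonal data to a square array *)

Section Band.

Variables (n b : nat) (D : nat -> nat -> int).
Hypothesis le_ba : (b <= n.+1)%N.

Definition band : pfarray n.+1 n.+1 :=
  \matrix_(i, j) (if ((j - i)%R < b)%N then Some (D (j - i)%R i) else None).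

Lemma bandE (i j : 'I_n.+1) :
  band i j = if ((j - i)%R < b)%N then Some (D (j - i)%R i) else None.
Proof. by rewrite mxE. Qed.

Variables (V : nmodType) (phi : option int -> V).
Hypothesis phi_empty : phi None = 0.

(** A general [phi] serves entry sums, counts of filled cells and sign sums alike. *)
Lemma sum_band_row (i : 'I_n.+1) :
  \sum_j phi (band i j) = \sum_(r < b) phi (Some (D r i)).
Proof.
rewrite (big_ord_widen n.+1 (fun r => phi (Some (D r i))) le_ba).
rewrite (reindex_inj (addIr i)) [RHS]big_mkcond /=; apply: eq_bigr => r _.
by rewrite bandE addrK; case: ifP.
Qed.

Lemma sum_band_col (j : 'I_n.+1) :
  \sum_i phi (band i j) = \sum_(r < b) phi (Some (D r (cyc_sub n.+1 j r))).
Proof.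
rewrite (big_ord_widen n.+1 (fun r => phi (Some (D r (cyc_sub n.+1 j r)))) le_ba).
rewrite (reindex_inj (subrI j)) [RHS]big_mkcond /=; apply: eq_bigr => r _.
by rewrite bandE subKr sub_ord_cyc; case: ifP.
Qed.

End Band.

Lemma card_set_sum (T : finType) (P : pred T) :
  #|[set x | P x]|%:Z = \sum_x (P x)%:Z.
Proof.
rewrite -sum1dep_card big_mkcond -[LHS]natz natr_sum.
by apply: eq_bigr => x _; case: (P x).
Qed.

Lemma sgz_pos_neg (c : option int) :
  (pos_cell c)%:Z - (neg_cell c)%:Z = sgz (odflt 0 c).
Proof. by case: c => [x|] //=; case: (sgzP x). Qed.

Lemma band_shiftable (n b : nat) (D : nat -> nat -> int) :
  (b <= n.+1)%N -> sign_balanced n.+1 b D -> shiftable (band n b D).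
Proof.
move=> le_ba [rowD colD]; split=> [i|j].
all: apply/eqP; rewrite -eqz_nat !card_set_sum -subr_eq0 -sumrB.
all: under eq_bigr do rewrite sgz_pos_neg; apply/eqP.
- by rewrite (sum_band_row _ le_ba (phi := fun c => sgz (odflt 0 c))) ?rowD.
- by rewrite (sum_band_col _ le_ba (phi := fun c => sgz (odflt 0 c))) ?colD.
Qed.

Lemma band_diagonal (n b : nat) (D : nat -> nat -> int) :
  (b <= n.+1)%N -> is_diagonal b (band n b D).
Proof.
move=> le_ba; exists 0 => i j; rewrite /filled bandE /in_diag.
have E (k : nat) : (k < n.+1)%N ->
    ((j%:Z - i%:Z == 0 + k%:Z %[mod n.+1%:Z])%Z) = (k == (j - i)%R :> nat).
  move=> kn; rewrite sub_ord_cyc /cyc_sub add0r.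
  have jn := ltn_ord j; have im := ltn_ord i.
  rewrite (modz_small (m := k)); last by lia.
  case: leqP => ij.
    by rewrite modz_small; lia.
  by rewrite -(modzDr (j%:Z - i%:Z) n.+1%:Z) modz_small; lia.
split.
  case: ifP => // rb _; exists (Ordinal rb); rewrite E ?eqxx //=.
  exact: leq_trans rb le_ba.
move=> [k]; rewrite E; last exact: leq_trans (ltn_ord k) le_ba.
by move/eqP <-; rewrite ltn_ord.
Qed.

(** Omega in increasing order, skipping 0 when [a * b] is even; the length is [a * b]. *)
Definition Omega_seq (a b : nat) : seq int :=
  [seq (if odd (a * b) || (k < (a * b)./2)%N then k%:Z - (a * b)./2%:Z
        else k.+1%:Z - (a * b)./2%:Z) | k <- iota 0 (a * b)].

Lemma mem_Omega_seq (a b : nat) (x : int) :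
  (absz x <= (a * b)./2)%N && (odd (a * b) || (x != 0)) -> x \in Omega_seq a b.
Proof.
rewrite /Omega_seq; move: (a * b)%N => c Ox; apply/mapP.
exists (absz (if odd c || (x < 0) then x + c./2%:Z else x + c./2%:Z - 1)).
  by rewrite mem_iota; case: ifP; lia.
case: (boolP (odd c)) Ox => oc /= Ox; case: (ltP x 0) => ? /=;
  by first [lia | case: ifP; lia].
Qed.

Lemma band_SMA (n b : nat) (D : nat -> nat -> int) :
  (b <= n.+1)%N -> diag_data n.+1 b D -> is_SMA b (band n b D).
Proof.
move=> le_ba [injD rangeD rowD colD]; split.
- move=> i j x; rewrite bandE OmegaE; case: ifP => // rb [<-].
  exact: rangeD.
- move=> i; apply/eqP; rewrite -eqz_nat card_set_sum.
  rewrite (sum_band_row _ le_ba (phi := fun c : option int => (isSome c)%:Z)) //.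
  by rewrite /= sumr_const card_ord natz.
- move=> j; apply/eqP; rewrite -eqz_nat card_set_sum.
  rewrite (sum_band_col _ le_ba (phi := fun c : option int => (isSome c)%:Z)) //.
  by rewrite /= sumr_const card_ord natz.
- move=> x; rewrite OmegaE => Ox.
  pose s1 := [seq D p.1 p.2 | p : 'I_b * 'I_n.+1].
  have s1U : uniq s1.
    rewrite map_inj_uniq ?enum_uniq // => -[r i] [r' i'] /= eqD.
    have := injD _ _ _ _ (ltn_ord r) (ltn_ord r') (ltn_ord i) (ltn_ord i') eqD.
    by move=> [/val_inj -> /val_inj ->].
  have s12 : {subset s1 <= Omega_seq n.+1 b}.
    by move=> y /mapP[[r i] _ ->]; apply: mem_Omega_seq; apply: rangeD.
  have szs : (size (Omega_seq n.+1 b) <= size s1)%N.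
    by rewrite size_map size_iota size_image card_prod !card_ord mulnC.
  have [_ /(_ x)] := uniq_min_size s1U s12 szs.
  rewrite mem_Omega_seq // => /mapP[[r i] _ /= xE].
  have rn : (r < n.+1)%N by apply: leq_trans le_ba.
  (* The entry [D r i] sits in row i and column r + i modulo [n.+1]. *)
  apply/eqP/cards1P; exists (i, (Ordinal rn + i)%R); apply/setP => -[i' j'].
  rewrite !inE [(_, _).1]/= [(_, _).2]/= bandE; apply/eqP/eqP => [|[-> ->]]; last first.
    by rewrite addrK /= ltn_ord xE.
  case: ifP => // rb [Dx].
  have [] := injD _ _ _ _ rb (ltn_ord r) (ltn_ord i') (ltn_ord i).
    by rewrite Dx.
  move=> er /val_inj <-; congr (_, _); rewrite (_ : Ordinal rn = j' - i') ?subrK //.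
  exact: val_inj.
- move=> i; rewrite /row_sum.
  by rewrite (sum_band_row _ le_ba (phi := odflt 0)) ?rowD.
- move=> j; rewrite /col_sum.
  by rewrite (sum_band_col _ le_ba (phi := odflt 0)) ?colD.
Qed.

(** * Appending four diagonals *)

Definition cyc_add (a i k : nat) : nat :=
  if (i + k < a)%N then (i + k)%N else (i + k - a)%N.

Lemma cyc_sub_lt (a j r : nat) : (j < a)%N -> (cyc_sub a j r < a)%N.
Proof. by rewrite /cyc_sub; case: ifP; lia. Qed.

Definition four (a N r i : nat) : int :=
  match r with
  | 0 => N%:Z + (2 * i).+1%:Z
  | 1 => - (N%:Z + (2 * i).+2%:Z)
  | 2 => - (N%:Z + (2 * cyc_add a i 2).+1%:Z)
  | _ => N%:Z + (2 * cyc_add a i 2).+2%:Z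
  end.

Definition add4 (a b : nat) (D : nat -> nat -> int) (r i : nat) : int :=
  if (r < b)%N then D r i else four a (a * b)./2 (r - b) i.

Lemma sum_add4 (V : nmodType) (phi : int -> V) (a b : nat) D (w : nat -> nat) :
  \sum_(r < b.+4) phi (add4 a b D r (w r)) =
  \sum_(r < b) phi (D r (w r)) +
  \sum_(k < 4) phi (four a (a * b)./2 k (w (b + k)%N)).
Proof.
rewrite -addn4 big_split_ord /=; congr (_ + _); apply: eq_bigr => r _.
  by rewrite /add4 ltn_ord.
by rewrite /add4 ltnNge leq_addr /= addKn.
Qed.

(** Absolute values exceed N by an odd number on diagonals 0 and 2, by an even one on 1 and 3;
    within each pair the signs differ. *)
Lemma four_inj (a N r r' i i' : nat) : (1 < a)%N ->
  (r < 4)%N -> (r' < 4)%N -> (i < a)%N -> (i' < a)%N ->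
  four a N r i = four a N r' i' -> r = r' /\ i = i'.
Proof.
move=> a1; case: r => [|[|[|[|//]]]] _;
  case: r' => [|[|[|[|//]]]] _; rewrite /four /cyc_add;
  repeat (case: ifP); lia.
Qed.

Lemma four_range (a N r i : nat) : (1 < a)%N -> (i < a)%N ->
  (N < absz (four a N r i) <= N + 2 * a)%N.
Proof.
by move=> a1; case: r => [|[|[|r]]]; rewrite /four /cyc_add; repeat (case: ifP); lia.
Qed.

(** The new absolute values lie in (N, N + 2a], above all those of [D], so old and new entries never
    collide. *)
Lemma add4_data (a b : nat) (D : nat -> nat -> int) :
  (b.+4 <= a)%N -> diag_data a b D -> diag_data a b.+4 (add4 a b D).
Proof.
move=> le_ba [injD rangeD rowD colD].
have N4 : (a * b.+4)./2 = ((a * b)./2 + 2 * a)%N by rewrite -addn4 mulnDr; lia.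
have odd4 : odd (a * b.+4) = odd (a * b) by rewrite -addn4 mulnDr; lia.
split.
- move=> r r' i i' rb rb' ia ia'; rewrite /add4.
  have Dsmall s k : (s < b)%N -> (k < a)%N -> (absz (D s k) <= (a * b)./2)%N.
    by move=> sb ka; case/andP: (rangeD s k sb ka).
  have flarge s k : (k < a)%N -> ((a * b)./2 < absz (four a (a * b)./2 s k))%N.
    by move=> ka; case/andP: (@four_range a (a * b)./2 s k ltac:(lia) ka).
  case: ltnP => rb0; case: ltnP => rb0' eqD.
  + exact: injD.
  + by move: (Dsmall _ _ rb0 ia) (flarge (r' - b)%N _ ia'); rewrite eqD leqNgt => /negP.
  + by move: (Dsmall _ _ rb0' ia') (flarge (r - b)%N _ ia); rewrite -eqD leqNgt => /negP.
  + have [er ->] : (r - b = r' - b)%N /\ i = i' by apply: (four_inj _ _ _ _ _ eqD); lia.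
    by lia.
- move=> r i rb ia; rewrite N4 odd4 /add4; case: ltnP => rb0.
    by have := rangeD r i rb0 ia; lia.
  by have := @four_range a (a * b)./2 (r - b) i ltac:(lia) ia; lia.
- move=> i ia; rewrite (sum_add4 id a b D (fun=> i)) rowD // add0r.
  by rewrite !big_ord_recr big_ord0 /= /four; lia.
(* With s = j - b modulo a, the new entries of the column are f(s), - g(s - 1), - f(s), g(s - 1). *)
- move=> j ja; rewrite (sum_add4 id a b D (cyc_sub a j)) colD // add0r.
  by rewrite !big_ord_recr big_ord0 /= /four /cyc_add /cyc_sub; repeat (case: ifP); lia.
Qed.

Lemma four_sgz (a N i : nat) :
  (sgz (four a N 0 i) = 1) * (sgz (four a N 1 i) = -1) *
  (sgz (four a N 2 i) = -1) * (sgz (four a N 3 i) = 1).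
Proof. by rewrite /four !sgzN !gtr0_sgz //; lia. Qed.

Lemma add4_balanced (a b : nat) (D : nat -> nat -> int) :
  sign_balanced a b D -> sign_balanced a b.+4 (add4 a b D).
Proof.
move=> [rowD colD]; split=> [i ia|j ja].
  rewrite (sum_add4 (@sgz int) a b D (fun=> i)) rowD // add0r.
  by rewrite !big_ord_recr big_ord0 !four_sgz.
rewrite (sum_add4 (@sgz int) a b D (cyc_sub a j)) colD // add0r.
by rewrite !big_ord_recr big_ord0 !four_sgz.
Qed.

(** * Base cases b = 0 and b = 6 *)

Lemma diag_data0 (a : nat) : diag_data a 0 (fun _ _ => 0).
Proof. by split=> // *; rewrite big_ord0. Qed.

Definition six (a r i : nat) : int :=
  let k := cyc_add a i 3 in
  match r with
  | 0 => - (2 * i).+2%:Z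
  | 1 => (a + i).+1%:Z
  | 2 => i%:Z - (3 * a)%:Z
  | 3 => (2 * k).+1%:Z - (2 * a)%:Z
  | 4 => a%:Z - k%:Z
  | _ => (3 * a)%:Z - k%:Z
  end.

(** Diagonals 0 and 3 take the even and odd values of [-2a, -1], diagonal 2 takes [-3a, -2a - 1]; 4,
    1, 5 take the thirds of [1, 3a]. In a row, diagonals 0, 1, 2 sum to - 2a - 1 and the others to
    2a + 1. In a column the shift by 3 pairs r with r + 3, with sums - 2a - 1, 2a + 1 and 0. *)
Lemma six_data (a : nat) : (6 <= a)%N -> diag_data a 6 (six a).
Proof.
move=> a6; split.
- move=> r r' i i'; case: r => [|[|[|[|[|[|//]]]]]] _;
  case: r' => [|[|[|[|[|[|//]]]]]] _; rewrite /six /cyc_add; repeat (case: ifP); lia.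
- move=> r i; case: r => [|[|[|[|[|[|//]]]]]] _; rewrite /six /cyc_add;
  repeat (case: ifP); lia.
- move=> i ia; rewrite !big_ord_recr big_ord0 /= /six; lia.
(* As r is at most 5, [cyc_sub] wraps round only in columns 0 to 4. *)
- case=> [|[|[|[|[|j]]]]] ja;
  rewrite !big_ord_recr big_ord0 /= /six /cyc_add /cyc_sub /=; repeat (case: ifP); lia.
Qed.

Lemma six_sgz (a i : nat) : (5 < a)%N -> (i < a)%N ->
  (sgz (six a 0 i) = -1) * (sgz (six a 1 i) = 1) * (sgz (six a 2 i) = -1) *
  (sgz (six a 3 i) = -1) * (sgz (six a 4 i) = 1) * (sgz (six a 5 i) = 1).
Proof.
move=> a6 ia; rewrite /six; set k := cyc_add a i 3.
have ka : (k < a)%N by rewrite /k /cyc_add; case: ifP; lia.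
do !split; first [apply: gtr0_sgz | apply: ltr0_sgz]; lia.
Qed.

Lemma six_balanced (a : nat) : (6 <= a)%N -> sign_balanced a 6 (six a).
Proof.
move=> a6; split=> [i ia|j ja]; rewrite !big_ord_recr big_ord0.
  by rewrite !six_sgz.
by rewrite !six_sgz ?cyc_sub_lt.
Qed.

(** * Base cases b = 3 and b = 5 *)

Ltac lia_ifs := repeat (case: ifP => ?; try (exfalso; lia)); lia.

(* Writing h(i) for the representative of i / 2 modulo a = 2n + 1 in [0, a), the
   diagonals are h(i) - i, i + n + 1 and - h(i) - n - 1. *)
Definition three_odd (n r i : nat) : int :=
  let y := i./2%:Z in
  match r with
  | 0 => if odd i then n%:Z - y else - y
  | 1 => i%:Z + n%:Z + 1
  | _ => if odd i then - y - 2 * n%:Z - 2 else - y - n%:Z - 1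
  end.

(** The diagonals fill [-n, n], [n + 1, 3n + 1] and [-3n - 1, -n - 1]. Columns cancel because h(j) =
    h(j - 2) + 1 modulo a. *)
Lemma three_odd_data (n : nat) : (1 <= n)%N -> diag_data (2 * n).+1 3 (three_odd n).
Proof.
move=> n1; split.
- move=> r r' i i'; case: r => [|[|[|//]]] _; case: r' => [|[|[|//]]] _ ia ia';
  rewrite /three_odd; lia_ifs.
- move=> r i; case: r => [|[|[|//]]] _ ia; rewrite /three_odd; lia_ifs.
- move=> i ia; rewrite !big_ord_recr big_ord0 /= /three_odd; lia_ifs.
- case=> [|[|j]] ja; rewrite !big_ord_recr big_ord0 /= /three_odd /cyc_sub /=; lia_ifs.
Qed.

(* For even a = 2m diagonal 1 carries the entries of absolute value at most m and
   increases by 1 from row to row except for a few jumps.  The line sums then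
   determine the other two diagonals up to additive constants on the rows of
   equal parity.  The jumps come from a computer search. *)
Definition three_0mod4 (q r i : nat) : int :=
  let m := (2 * q)%N in let y := i./2 in
  match r with
  | 0 => if odd i then (2 * m + q)%:Z - y%:Z
         else if y == 0%N then (2 * m + q).+1%:Z
         else if (y <= q)%N then (m + q).+1%:Z - y%:Z
         else (3 * m + q).+1%:Z - y%:Z
  | 1 => if i == 0%N then - m%:Z
         else if (i <= m)%N then i%:Z
         else i%:Z - (2 * m)%:Z
  | _ => if odd i then
           if (y < q)%N then - (2 * m + q).+1%:Z - y%:Z
           else q%:Z - m.+1%:Z - y%:Z
         else - (m + q).+1%:Z - y%:Z
  end.

Lemma three_0mod4_data (q : nat) : (1 <= q)%N -> diag_data (4 * q) 3 (three_0mod4 q).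
Proof.
move=> q1; split.
- move=> r r' i i'; case: r => [|[|[|//]]] _; case: r' => [|[|[|//]]] _ ia ia';
  rewrite /three_0mod4; lia_ifs.
- move=> r i; case: r => [|[|[|//]]] _ ia; rewrite /three_0mod4; lia_ifs.
- move=> i ia; rewrite !big_ord_recr big_ord0 /= /three_0mod4; lia_ifs.
- case=> [|[|j]] ja; rewrite !big_ord_recr big_ord0 /= /three_0mod4 /cyc_sub /=; lia_ifs.
Qed.

(** With a = 2m, diagonal 1 again fills ±1, ..., ±m, diagonal 0 fills [m + 1, 3m] and diagonal 2 the
    negatives of these. *)
Definition three_2mod4 (q r i : nat) : int :=
  let m := (2 * q).+1 in let y := i./2 in
  match r with
  | 0 => if odd i then
           if (y <= q)%N then (m + q).+1%:Z - y%:Z else (2 * m + q).+2%:Z - y%:Z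
         else if y == 0%N then (2 * m + q).+2%:Z
         else if y == 1%N then (m + q).+2%:Z
         else if (y <= q.+1)%N then (2 * m + q).+3%:Z - y%:Z
         else (3 * m + q).+2%:Z - y%:Z
  | 1 => if i == 0%N then - 1
         else if i == 1%N then m%:Z - 1
         else if i == 2%N then m%:Z
         else if (i <= m)%N then i%:Z - 2
         else if i == m.+1 then - 2
         else i%:Z - (2 * m).+2%:Z
  | _ => if odd i then
           if y == 0%N then - (2 * m + q)%:Z
           else if (y <= q)%N then - (m + q)%:Z - y%:Z
           else - q.+1%:Z - y%:Z
         else if (y <= q)%N then - (2 * m + q).+1%:Z - y%:Z
         else - (m + q)%:Z - y%:Z
  end.

Lemma three_2mod4_data (q : nat) : (1 <= q)%N ->
  diag_data (4 * q).+2 3 (three_2mod4 q).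
Proof.
move=> q1; split.
- move=> r r' i i'; case: r => [|[|[|//]]] _; case: r' => [|[|[|//]]] _ ia ia';
  rewrite /three_2mod4; lia_ifs.
- move=> r i; case: r => [|[|[|//]]] _ ia; rewrite /three_2mod4; lia_ifs.
- move=> i ia; rewrite !big_ord_recr big_ord0 /= /three_2mod4; lia_ifs.
- case=> [|[|j]] ja; rewrite !big_ord_recr big_ord0 /= /three_2mod4 /cyc_sub /=; lia_ifs.
Qed.

(* Diagonals 2 and 4 sum to a constant in rows, diagonals 0 and 2 in columns, so
   that the line sums reduce to i = h(i) + h(i - 1) - n modulo constants, where
   h(i) is i / 2 modulo a = 2n + 1, on diagonal 3, and h(i - 1) is on diagonal 1. *)
Definition five_odd (n r i : nat) : int :=
  let y := i./2 in let s := cyc_add (2 * n).+1 i 2 in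
  match r with
  | 0 => n%:Z - i%:Z
  | 1 => if odd i then y%:Z + n.+1%:Z else y%:Z + (2 * n).+1%:Z
  | 2 => s%:Z - (3 * n).+1%:Z
  | 3 => if odd i then y%:Z + (4 * n).+3%:Z else y%:Z + (3 * n).+2%:Z
  | _ => - s%:Z - (3 * n).+2%:Z
  end.

(** The diagonals fill the blocks [-n, n], [n + 1, 3n + 1], [-3n - 1, -n - 1], [3n + 2, 5n + 2],
    [-5n - 2, -3n - 2]. *)
Lemma five_odd_data (n : nat) : (2 <= n)%N -> diag_data (2 * n).+1 5 (five_odd n).
Proof.
move=> n2; split.
- move=> r r' i i'; case: r => [|[|[|[|[|//]]]]] _;
  case: r' => [|[|[|[|[|//]]]]] _ ia ia';
  rewrite /five_odd /cyc_add; lia_ifs.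
- move=> r i; case: r => [|[|[|[|[|//]]]]] _ ia; rewrite /five_odd /cyc_add; lia_ifs.
- move=> i ia; rewrite !big_ord_recr big_ord0 /= /five_odd /cyc_add; lia_ifs.
- case=> [|[|[|[|j]]]] ja;
  rewrite !big_ord_recr big_ord0 /= /five_odd /cyc_add /cyc_sub /=; lia_ifs.
Qed.

(* For even a diagonals 0 and 4 decrease and diagonal 2 increases by 1 from row to
   row, up to jumps.  The line sums then determine diagonals 1 and 3 up to
   additive constants on the rows of equal parity.  The jumps come from a
   computer search. *)
Definition five_0mod4 (q r i : nat) : int :=
  let m := (2 * q)%N in let y := i./2 in
  match r with
  | 0 => - (3 * m).+1%:Z - i%:Z
  | 1 => if odd i then
           if (y < q.-1)%N then (3 * m).+1%:Z + y%:Z else (4 * m).+1%:Z + y%:Z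
         else if (y < q)%N then (4 * m)%:Z + y%:Z else (3 * m)%:Z + y%:Z
  | 2 => if i.+2 == m then - (3 * m)%:Z
         else if i.+1 == (2 * m)%N then 1 - (3 * m)%:Z
         else i%:Z + 2 - (3 * m)%:Z
  | 3 => if odd i then
           if (y < q.-1)%N then y%:Z + 2
           else if (y.+2 < m)%N then y%:Z + 2 - m%:Z
           else if y.+2 == m then - (2 * m)%:Z
           else 1
         else if (y < q.-1)%N then y%:Z + 2 - m%:Z
         else if (y.+1 < m)%N then y%:Z + 2
         else 1 - m%:Z
  | _ => if (i + 3 < 2 * m)%N then (3 * m)%:Z - 3 - i%:Z
         else (5 * m)%:Z - 3 - i%:Z
  end.

(** Diagonals 0, 1, 4 fill [-5m, -3m - 1], [3m + 1, 5m], [m + 1, 3m]. Diagonal 2 fills [-3m, -m]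
    without - 2m, which diagonal 3 takes in place of - m. *)
Lemma five_0mod4_data (q : nat) : (2 <= q)%N -> diag_data (4 * q) 5 (five_0mod4 q).
Proof.
move=> q2; split.
- move=> r r' i i'; case: r => [|[|[|[|[|//]]]]] _;
  case: r' => [|[|[|[|[|//]]]]] _ ia ia';
  rewrite /five_0mod4; lia_ifs.
- move=> r i; case: r => [|[|[|[|[|//]]]]] _ ia; rewrite /five_0mod4; lia_ifs.
- move=> i ia; rewrite !big_ord_recr big_ord0 /= /five_0mod4; lia_ifs.
- case=> [|[|[|[|j]]]] ja;
  rewrite !big_ord_recr big_ord0 /= /five_0mod4 /cyc_sub /=; lia_ifs.
Qed.

(** Diagonal 2 is i + 1 - m with 0 replaced by - m. Diagonals 1 and 4 fill [m + 1, 3m] and its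
    negatives, 3 and 0 fill [3m + 1, 5m] and its negatives. *)
Definition five_2mod4 (q r i : nat) : int :=
  let m := (2 * q).+1 in let y := i./2 in
  match r with
  | 0 => - (3 * m).+1%:Z - i%:Z
  | 1 => if odd i then
           if (y < q)%N then m.+2%:Z + y%:Z
           else if y == (2 * q)%N then m.+1%:Z
           else (2 * m).+2%:Z + y%:Z
         else if (y <= q)%N then (2 * m).+1%:Z + y%:Z else m.+1%:Z + y%:Z
  | 2 => if i.+1 == m then - m%:Z else i.+1%:Z - m%:Z
  | 3 => if odd i then
           if (y < q)%N then (4 * m).+2%:Z + y%:Z else (3 * m).+2%:Z + y%:Z
         else if (y < q)%N then (3 * m).+2%:Z + y%:Z
         else if y == (2 * q)%N then (3 * m).+1%:Z
         else (4 * m).+2%:Z + y%:Z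
  | _ => - m.+1%:Z - (cyc_add (2 * m) i 2)%:Z
  end.

Lemma five_2mod4_data (q : nat) : (1 <= q)%N ->
  diag_data (4 * q).+2 5 (five_2mod4 q).
Proof.
move=> q1; split.
- move=> r r' i i'; case: r => [|[|[|[|[|//]]]]] _;
  case: r' => [|[|[|[|[|//]]]]] _ ia ia';
  rewrite /five_2mod4 /cyc_add; lia_ifs.
- move=> r i; case: r => [|[|[|[|[|//]]]]] _ ia; rewrite /five_2mod4 /cyc_add; lia_ifs.
- move=> i ia; rewrite !big_ord_recr big_ord0 /= /five_2mod4 /cyc_add; lia_ifs.
- case=> [|[|[|[|j]]]] ja;
  rewrite !big_ord_recr big_ord0 /= /five_2mod4 /cyc_add /cyc_sub /=; lia_ifs.
Qed.

(** * Reaching every b >= 3 *)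

Lemma diag_data3 (a : nat) : (3 <= a)%N -> exists D, diag_data a 3 D.
Proof.
move=> a3.
have [aE|[aE|aE]] : a = (2 * a./2).+1 \/ a = (4 * (a %/ 4))%N \/ a = (4 * (a %/ 4)).+2
  by lia.
- by rewrite aE; eexists; apply: three_odd_data; lia.
- by rewrite aE; eexists; apply: three_0mod4_data; lia.
- by rewrite aE; eexists; apply: three_2mod4_data; lia.
Qed.

Lemma diag_data5 (a : nat) : (5 <= a)%N -> exists D, diag_data a 5 D.
Proof.
move=> a5.
have [aE|[aE|aE]] : a = (2 * a./2).+1 \/ a = (4 * (a %/ 4))%N \/ a = (4 * (a %/ 4)).+2
  by lia.
- by rewrite aE; eexists; apply: five_odd_data; lia.
- by rewrite aE; eexists; apply: five_0mod4_data; lia.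
- by rewrite aE; eexists; apply: five_2mod4_data; lia.
Qed.

(** Sign balance is carried as an implication so that one induction serves both parities of b. *)
Lemma diag_data_add (a b k : nat) (D : nat -> nat -> int) :
  (b + 4 * k <= a)%N -> diag_data a b D ->
  exists D', diag_data a (b + 4 * k) D' /\
    (sign_balanced a b D -> sign_balanced a (b + 4 * k) D').
Proof.
elim: k => [|k IHk] le_ba dataD; first by exists D; rewrite muln0 addn0.
have [|D' [dataD' balD']] := IHk _ dataD; first by lia.
have -> : (b + 4 * k.+1 = (b + 4 * k).+4)%N by lia.
exists (add4 a (b + 4 * k) D'); split; first by apply: add4_data; [lia|].
by move=> balD; apply: add4_balanced; apply: balD'.
Qed.

Lemma diag_data_odd (a b : nat) : (3 <= b)%N -> (b <= a)%N -> odd b ->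
  exists D, diag_data a b D.
Proof.
move=> b3 le_ba ob.
have [bE|bE] : b = (3 + 4 * ((b - 3) %/ 4))%N \/ b = (5 + 4 * ((b - 5) %/ 4))%N by lia.
- rewrite bE; have [|D dataD] := @diag_data3 a; first by lia.
  by have [|D' []] := diag_data_add (k := (b - 3) %/ 4) _ dataD; [lia | exists D'].
- rewrite bE; have [|D dataD] := @diag_data5 a; first by lia.
  by have [|D' []] := diag_data_add (k := (b - 5) %/ 4) _ dataD; [lia | exists D'].
Qed.

Lemma diag_data_even (a b : nat) : (3 <= b)%N -> (b <= a)%N -> ~~ odd b ->
  exists D, diag_data a b D /\ sign_balanced a b D.
Proof.
move=> b3 le_ba eb.
have [bE|bE] : b = (0 + 4 * (b %/ 4))%N \/ b = (6 + 4 * ((b - 6) %/ 4))%N by lia.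
- rewrite bE.
  have [|D' [dataD' balD']] := diag_data_add (k := b %/ 4) _ (diag_data0 a);
    first by lia.
  by exists D'; split=> //; apply: balD'; split=> *; rewrite big_ord0.
- have a6 : (6 <= a)%N by lia.
  rewrite bE.
  have [|D' [dataD' balD']] := diag_data_add (k := (b - 6) %/ 4) _ (six_data a6);
    first by lia.
  by exists D'; split=> //; apply: balD'; apply: six_balanced.
Qed.

Close Scope ring_scope.

Theorem corollary5p6 :
  (forall a b : nat, 3 <= b -> b <= a ->
     exists A : pfarray a a, is_SMA b A /\ is_diagonal b A) /\
  (forall a b : nat, 3 <= b -> b <= a -> ~~ odd b ->
     exists A : pfarray a a, [/\ is_SMA b A, is_diagonal b A & shiftable A]).
Proof.
have even a b : 3 <= b -> b <= a -> ~~ odd b ->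
    exists A : pfarray a a, [/\ is_SMA b A, is_diagonal b A & shiftable A].
  case: a => [|n] b3 le_ba eb; first by lia.
  have [D [dataD balD]] := diag_data_even b3 le_ba eb.
  exists (band n b D); split.
  - exact: band_SMA.
  - exact: band_diagonal.
  - exact: band_shiftable.
split=> // a b b3 le_ba; case: (boolP (odd b)) => [ob|eb]; last first.
  by have [A []] := even a b b3 le_ba eb; exists A.
case: a le_ba => [|n] le_ba; first by lia.
have [D dataD] := diag_data_odd b3 le_ba ob.
by exists (band n b D); split; [apply: band_SMA | apply: band_diagonal].
Qed.
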